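(* There is a deterministic procedure with the following property. Let $\mathbb{F}$ be a field, $\mathcal{P}=\mathbb{F}[X_1,\ldots,X_n]$ the commutative polynomial ring, $\mathsf{I}\subset\mathcal{P}$ an ideal, $\prec$ a noetherian semigroup term-ordering on the set of terms $\mathcal{T}=\{X_1^{a_1}\cdots X_n^{a_n}:(a_1,\ldots,a_n)\in\mathbb{N}^n\}$, and $D\in\mathbb{N}$ a value satisfying $D\geq d(\mathsf{I}):=\max\{\deg(\gamma):\gamma\in\Gamma(\mathsf{I})\}$, where $\Gamma(\mathsf{I})$ is the Gröbner basis of $\mathsf{I}$ with respect to $\prec$. The procedure is given $\mathcal{P}$, $\prec$ and $D$, and accesses $\mathsf{I}$ only through an oracle which, queried with a term $\tau\in\mathcal{T}$, returns the canonical form $\mathrm{Can}(\tau,\mathsf{I},\prec)$. After finitely many steps and finitely many oracle queries the procedure terminates and outputs the Gröbner basis $\Gamma(\mathsf{I})$ of $\mathsf{I}$ with respect to $\prec$.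
   Context: A noetherian semigroup term-ordering $\prec$ on $\mathcal{T}$ is a well-ordering compatible with multiplication. $\deg$ is the usual total degree, with $\deg(X_i)=1$ for all $i$. For $0\neq f\in\mathcal{P}$, $\mathbf{T}(f)$ denotes the $\prec$-maximal term occurring in $f$ with nonzero coefficient. Put $\mathbf{T}(\mathsf{I})=\{\mathbf{T}(f):0\neq f\in\mathsf{I}\}$ and $\mathbf{N}(\mathsf{I})=\mathcal{T}\setminus\mathbf{T}(\mathsf{I})$, and let $\mathbf{G}(\mathsf{I})$ be the unique minimal basis (generating set) of the semigroup ideal $\mathbf{T}(\mathsf{I})$. For $f\in\mathcal{P}$, $\mathrm{Can}(f,\mathsf{I},\prec)$ is the unique element $g\in\mathrm{Span}_{\mathbb{F}}(\mathbf{N}(\mathsf{I}))$ such that $f-g\in\mathsf{I}$. The (reduced) Gröbner basis is $\Gamma(\mathsf{I})=\{\tau-\mathrm{Can}(\tau,\mathsf{I},\prec):\tau\in\mathbf{G}(\mathsf{I})\}$, which is finite. If $\mathsf{I}=(0)$, then $\Gamma(\mathsf{I})=\emptyset$ and the condition on $D$ is vacuous. Arithmetic in $\mathbb{F}$ is assumed to be effective. *)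

(* Defs.v *)
From HB Require Import structures.
From mathcomp Require Import all_boot all_order all_algebra.
From mathcomp Require Export mpoly.
From Stdlib Require Export ClassicalEpsilon.

Set Implicit Arguments.
Unset Strict Implicit.
Unset Printing Implicit Defensive.

Import GRing.Theory.
Local Open Scope ring_scope.

(** * Gröbner bases with respect to an arbitrary term-ordering

    [mlead] and the canonical order on ['X_{1..n}] refer to one fixed
    (graded) ordering, so leading terms are defined here for an arbitrary
    strict ordering [prec]. *)

Record term_ordering (n : nat) (prec : rel 'X_{1..n}) : Prop := TermOrdering {
  prec_irr : forall t, ~~ prec t t;
  prec_trans : forall t1 t2 t3, prec t1 t2 -> prec t2 t3 -> prec t1 t3;
  prec_total : forall t1 t2, t1 != t2 -> prec t1 t2 || prec t2 t1;
  prec_mul : forall t t1 t2, prec t1 t2 -> prec (t + t1)%MM (t + t2)%MM;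
  prec_wf : well_founded (fun t1 t2 => prec t1 t2)
}.

(** The library's ideals are decidable and proper; here [I] is any ideal,
    including (0) and (1). *)
Record is_ideal (F : fieldType) (n : nat) (I : {mpoly F[n]} -> Prop) : Prop :=
  IsIdeal {
  ideal0 : I 0;
  idealD : forall f g, I f -> I g -> I (f + g);
  idealM : forall f g, I g -> I (f * g)
}.

Section Groebner.

Context (F : fieldType) (n : nat) (prec : rel 'X_{1..n}).
Implicit Types (f g : {mpoly F[n]}) (t : 'X_{1..n}).

Definition is_leading f t : Prop :=
  t \in msupp f /\ forall u, u \in msupp f -> u != t -> prec u t.

Context (I : {mpoly F[n]} -> Prop).

Definition lead_terms t : Prop :=
  exists f, [/\ I f, f != 0 & is_leading f t].

Definition normal_terms t : Prop := ~ lead_terms t.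

(** [(u <= t)%MM] is divisibility of terms. *)
Definition generated_by (B : 'X_{1..n} -> Prop) t : Prop :=
  exists2 u, B u & (u <= t)%MM.

Definition generates (B T : 'X_{1..n} -> Prop) : Prop :=
  forall t, T t <-> generated_by B t.

Definition minimal_basis (T B : 'X_{1..n} -> Prop) : Prop :=
  generates B T /\
  forall B' : 'X_{1..n} -> Prop,
    (forall t, B' t -> B t) -> generates B' T -> forall t, B t -> B' t.

Definition lead_basis : 'X_{1..n} -> Prop :=
  epsilon (inhabits (fun=> False)) (minimal_basis lead_terms).

(** A polynomial lies in the linear span of a set of terms iff its support
    is contained in that set. *)
Definition is_canonical f g : Prop :=
  (forall t, t \in msupp g -> normal_terms t) /\ I (f - g).

Definition Can f : {mpoly F[n]} := epsilon (inhabits 0) (is_canonical f).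

Definition groebner g : Prop :=
  exists2 t, lead_basis t & g = 'X_[t] - Can 'X_[t].

End Groebner.

(** [msize] is one more than the degree, and 0 for the zero polynomial. *)
Definition tdeg (F : fieldType) (n : nat) (f : {mpoly F[n]}) : nat :=
  (msize f).-1.

(** * Oracle procedures

    A procedure is the text of a while program; it mentions neither the field,
    nor the number of variables, nor the ordering, nor the ideal. It computes
    with binary trees whose leaves are natural numbers or field elements.
    Field arithmetic (including the zero test) and the comparison of terms are
    elementary operations. *)

Inductive value (F : Type) : Type :=
| VNil
| VNat of nat
| VElt of F
| VPair of value F & value F.

Arguments VNil {F}.
Arguments VNat {F}.

Inductive expr : Type :=
| EVar of nat
| ENil
| EPair of expr & expr
| EHead of expr
| ETail of expr
| ENat of nat
| ENadd of expr & expr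
| ENsub of expr & expr
| EFzero
| EFone
| EFadd of expr & expr
| EFopp of expr
| EFmul of expr & expr
| EFinv of expr
| EEq of expr & expr
| EPrec of expr & expr.

(** [CQuery x e] stores in the variable [x] the answer of the oracle to the
    query [e]; there is no other access to the oracle. *)
Inductive cmd : Type :=
| CAssign of nat & expr
| CQuery of nat & expr
| CSeq of cmd & cmd
| CIf of expr & cmd & cmd
| CWhile of expr & cmd.

Section Semantics.

Context (F : fieldType).
Implicit Types (u v : value F) (s : nat -> value F).

Definition vhead v := if v is VPair a _ then a else VNil.
Definition vtail v := if v is VPair _ b then b else VNil.

Fixpoint value_eqb u v : bool :=
  match u, v with
  | VNil, VNil => true
  | VNat i, VNat j => i == j
  | VElt a, VElt b => a == b
  | VPair u1 u2, VPair v1 v2 => value_eqb u1 v1 && value_eqb u2 v2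
  | _, _ => false
  end.

(** Truth values: [VNil] is false, every other value is true. *)
Definition vbool (b : bool) : value F := if b then VNat 1 else VNil.
Definition vtrue v : bool := if v is VNil then false else true.

Definition vnat2 (op : nat -> nat -> nat) u v : value F :=
  if (u, v) is (VNat i, VNat j) then VNat (op i j) else VNil.
Definition velt1 (op : F -> F) u : value F :=
  if u is VElt a then VElt (op a) else VNil.
Definition velt2 (op : F -> F -> F) u v : value F :=
  if (u, v) is (VElt a, VElt b) then VElt (op a b) else VNil.

Context (compare : value F -> value F -> bool) (oracle : value F -> value F).

Fixpoint eval s (e : expr) : value F :=
  match e with
  | EVar x => s x
  | ENil => VNil
  | EPair e1 e2 => VPair (eval s e1) (eval s e2)
  | EHead e1 => vhead (eval s e1)
  | ETail e1 => vtail (eval s e1)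
  | ENat k => VNat k
  | ENadd e1 e2 => vnat2 addn (eval s e1) (eval s e2)
  | ENsub e1 e2 => vnat2 subn (eval s e1) (eval s e2)
  | EFzero => VElt 0
  | EFone => VElt 1
  | EFadd e1 e2 => velt2 +%R (eval s e1) (eval s e2)
  | EFopp e1 => velt1 -%R (eval s e1)
  | EFmul e1 e2 => velt2 *%R (eval s e1) (eval s e2)
  | EFinv e1 => velt1 GRing.inv (eval s e1)
  | EEq e1 e2 => vbool (value_eqb (eval s e1) (eval s e2))
  | EPrec e1 e2 => vbool (compare (eval s e1) (eval s e2))
  end.

Definition update s (x : nat) v : nat -> value F :=
  fun y => if y == x then v else s y.

(** A configuration is the list of commands still to be executed together
    with the contents of the variables. A step makes at most one query. *)
Definition config : Type := (seq cmd * (nat -> value F))%type.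

Definition step (c : config) : config :=
  let: (k, s) := c in
  match k with
  | [::] => ([::], s)
  | CAssign x e :: k' => (k', update s x (eval s e))
  | CQuery x e :: k' => (k', update s x (oracle (eval s e)))
  | CSeq c1 c2 :: k' => ([:: c1, c2 & k'], s)
  | CIf e c1 c2 :: k' => ((if vtrue (eval s e) then c1 else c2) :: k', s)
  | CWhile e c1 :: k' =>
      (if vtrue (eval s e) then [:: c1, CWhile e c1 & k'] else k', s)
  end.

(** The inputs are in variables 0 and 1, the output is in variable 0. *)
Definition init u v : nat -> value F :=
  fun x => match x with 0 => u | 1 => v | _ => VNil end.

Definition outputs (p : cmd) s v : Prop :=
  exists N, let: (k, s') := iter N step ([:: p], s) in k = [::] /\ s' 0%N = v.

End Semantics.

(** * Representation of terms and polynomials *)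

Section Encoding.

Context (F : fieldType) (n : nat) (prec : rel 'X_{1..n}).

Definition enc_seq (s : seq (value F)) : value F := foldr (@VPair F) VNil s.

Definition enc_term (t : 'X_{1..n}) : value F :=
  enc_seq [seq VNat (t i) | i <- enum 'I_n].

(** Every value is read as a term: missing or ill-formed exponents are 0. *)
Definition dec_term (v : value F) : 'X_{1..n} :=
  [multinom (if vhead (iter i (@vtail F) v) is VNat k then k else 0%N) | i < n].

(** The pairs (term, nonzero coefficient), by decreasing term. *)
Definition enc_poly (f : {mpoly F[n]}) : value F :=
  enc_seq [seq VPair (enc_term t) (VElt f@_t)
          | t <- sort (fun t u => ~~ prec t u) (msupp f)].

Definition compare_terms (u v : value F) : bool :=
  prec (dec_term u) (dec_term v).

Definition can_oracle (I : {mpoly F[n]} -> Prop) (v : value F) : value F :=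
  enc_poly (Can prec I 'X_[dec_term v]).

(** The procedure [p], given [n] and [D], the field operations, the comparison
    of terms and the oracle for [I], halts and outputs the list [gs]. *)
Definition computes (p : cmd) (I : {mpoly F[n]} -> Prop) (D : nat)
    (gs : seq {mpoly F[n]}) : Prop :=
  outputs compare_terms (can_oracle I) p (init (VNat n) (VNat D))
    (enc_seq [seq enc_poly g | g <- gs]).

End Encoding.

(* Main.v *)
Require Import Defs.
From mathcomp Require Import all_boot all_order all_algebra.
From Stdlib Require Import FunctionalExtensionality.

(** Since [D] bounds the degrees of the elements of the Gröbner basis, it bounds
    the exponents of their leading terms, so it suffices to examine the finitely
    many terms with exponents at most [D]. A term [t] is normal iff the oracle
    answers [t] itself, and [t] belongs to G(I) iff [t] is not normal while all
    the [t / X_i] are. For such a [t], all terms of [Can t] are smaller than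
    [t], so that the sorted list of [t - Can t] is the answer of the oracle with
    negated coefficients, preceded by [(t, 1)]: no comparison of terms is ever
    needed. *)

Set Implicit Arguments.
Unset Strict Implicit.
Unset Printing Implicit Defensive.

Import GRing.Theory.
Local Open Scope ring_scope.

(* The procedure as a while program *)
Declare Scope cmd_scope.
Local Open Scope cmd_scope.
Local Notation "x ::= e" := (CAssign x e) (at level 60) : cmd_scope.
Local Notation "c1 ;; c2" := (CSeq c1 c2)
  (at level 65, right associativity) : cmd_scope.

Definition enot (e : expr) : expr := EEq e ENil.
Definition epos (e : expr) : expr := enot (EEq e (ENat 0)).
(** The polynomial with the single term [t] and coefficient 1: the oracle gives this answer exactly
    when [t] is normal. *)
Definition emonomial (t : expr) : expr := EPair (EPair t EFone) ENil.

(* Variable 0 holds the number of coordinates still to be enumerated, then the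
   output; 2 and 3 hold lists of terms; 4 the current term; 5 an exponent;
   6 the answer of the oracle; 7 a flag; 8 and 9 the reversed beginning and the
   rest of the current term; 10 and 11 are used to build lists. *)
Definition crevapp (q a : nat) : cmd :=
  CWhile (EVar q)
    (a ::= EPair (EHead (EVar q)) (EVar a) ;; q ::= ETail (EVar q)).

Definition cexponents : cmd :=
  CWhile (epos (EVar 5))
    (5 ::= ENsub (EVar 5) (ENat 1) ;;
     3 ::= EPair (EPair (EVar 5) (EVar 4)) (EVar 3)).

Definition cextend : cmd :=
  CWhile (EVar 2)
    (4 ::= EHead (EVar 2) ;; 2 ::= ETail (EVar 2) ;;
     5 ::= ENadd (EVar 1) (ENat 1) ;; cexponents ;;
     4 ::= ENil ;; 5 ::= ENil).

Definition cbox : cmd :=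
  CWhile (epos (EVar 0))
    (0 ::= ENsub (EVar 0) (ENat 1) ;; cextend ;;
     2 ::= EVar 3 ;; 3 ::= ENil).

(** Scans the current term for its quotients t / X_i: at each positive exponent the lowered term is
    rebuilt from the reversed beginning and the rest, and flag 7 is cleared if it is not normal. At
    a zero exponent, [10 ::= ENil] changes nothing. *)
Definition cpreds : cmd :=
  CWhile (EVar 9)
    (5 ::= EHead (EVar 9) ;; 9 ::= ETail (EVar 9) ;;
     CIf (epos (EVar 5))
       (10 ::= EPair (ENsub (EVar 5) (ENat 1)) (EVar 9) ;;
        11 ::= EVar 8 ;; crevapp 11 10 ;;
        CQuery 11 (EVar 10) ;;
        CIf (EEq (EVar 11) (emonomial (EVar 10))) (11 ::= ENil) (7 ::= ENil) ;;
        10 ::= ENil ;; 11 ::= ENil)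
       (10 ::= ENil) ;;
     8 ::= EPair (EVar 5) (EVar 8) ;; 5 ::= ENil).

Definition cneg : cmd :=
  CWhile (EVar 6)
    (10 ::= EPair (EPair (EHead (EHead (EVar 6)))
                        (EFopp (ETail (EHead (EVar 6))))) (EVar 10) ;;
     6 ::= ETail (EVar 6)).

(** [cneg] leaves the negated answer reversed, so a second reversal restores the decreasing order
    before [(t, 1)] is put in front. *)
Definition cemit : cmd :=
  cneg ;; 11 ::= EVar 10 ;; 10 ::= ENil ;; crevapp 11 10 ;;
  0 ::= EPair (EPair (EPair (EVar 4) EFone) (EVar 10)) (EVar 0) ;;
  10 ::= ENil.

Definition cselect : cmd :=
  CWhile (EVar 2)
    (4 ::= EHead (EVar 2) ;; 2 ::= ETail (EVar 2) ;;
     CQuery 6 (EVar 4) ;;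
     CIf (EEq (EVar 6) (emonomial (EVar 4)))
       (6 ::= ENil)
       (7 ::= ENat 1 ;; 9 ::= EVar 4 ;; cpreds ;; 8 ::= ENil ;;
        CIf (EVar 7) cemit (6 ::= ENil) ;; 7 ::= ENil) ;;
     4 ::= ENil).

(** [EPair ENil ENil] is the list whose only element is the empty exponent list, the seed from which
    [cbox] adds one coordinate per round. *)
Definition cgroebner : cmd :=
  2 ::= EPair ENil ENil ;; cbox ;; 0 ::= ENil ;; cselect.

(** * Enumeration of exponent lists *)

Definition extend (D : nat) (L : seq (seq nat)) : seq (seq nat) :=
  [seq e :: s | s <- rev L, e <- iota 0 D.+1].

Definition box (n D : nat) : seq (seq nat) := iter n (extend D) [:: [::]].

Lemma box_uniq n D : uniq (box n D).
Proof.
elim: n => //= n IHn; apply: allpairs_uniq; rewrite ?rev_uniq ?iota_uniq //.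
by case=> [s1 e1] [s2 e2] _ _ /= [-> ->].
Qed.

Lemma mem_box n D s : (s \in box n D) = (size s == n) && all (leq^~ D) s.
Proof.
elim: n s => [|n IHn] s; first by rewrite mem_seq1; case: s.
apply/allpairsP/idP => [[[t e]] [+ + ->]|].
  rewrite mem_rev IHn mem_iota add0n ltnS => /andP[/eqP <- tD] /= eD.
  by rewrite eqxx eD.
case: s => [|e s]//= /andP[s_n /andP[eD sD]].
exists (s, e); split; last by [].
  by rewrite mem_rev IHn sD andbT.
by move: (mem_iota 0 D.+1 e); rewrite /= add0n ltnS eD.
Qed.

(* The lists obtained from [catrev P S] by lowering one nonzero entry of [S]. *)
Fixpoint lowerings (P S : seq nat) : seq (seq nat) :=
  if S is h :: S' then
    (if (0 < h)%N then [:: catrev P (h.-1 :: S')] else [::])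
      ++ lowerings (h :: P) S'
  else [::].

Lemma mem_lowerings P S s :
  reflect (exists i, [/\ (i < size S)%N, (0 < nth 0%N S i)%N
     & s = catrev P (set_nth 0%N S i (nth 0%N S i).-1)])
    (s \in lowerings P S).
Proof.
elim: S P s => [|h S IHS] P s /=; first by apply: (iffP idP) => // -[i []].
rewrite mem_cat; apply: (iffP orP) => [[|/IHS[i [ltiS Si ->]]]|].
- by case: ifP => // h_gt0; rewrite mem_seq1 => /eqP ->; exists 0%N.
- by exists i.+1.
case=> -[|i] [/= ltiS Si ->]; first by rewrite Si mem_seq1 eqxx; left.
by right; apply/IHS; exists i.
Qed.

(** * Execution of the program for an arbitrary comparison and oracle *)

Section Run.

Context (F : fieldType) (compare : value F -> value F -> bool).
Context (answer : value F -> seq (value F * F)).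

Implicit Types (vs : seq (value F)) (s : seq nat).

Definition enc_monomials (l : seq (value F * F)) : value F :=
  enc_seq [seq VPair m.1 (VElt m.2) | m <- l].
Definition enc_nats s : value F := enc_seq [seq VNat i | i <- s].

Let oracle v := enc_monomials (answer v).

(** The outcome of the program's test, meaningful for any oracle; [reducedP] ties it to
    normality. *)
Definition reduced s : bool :=
  value_eqb (oracle (enc_nats s))
    (VPair (VPair (enc_nats s) (VElt 1)) VNil).

Definition basis_term s : bool :=
  ~~ reduced s && all reduced (lowerings [::] s).

Definition basis_value s : value F :=
  VPair (VPair (enc_nats s) (VElt 1))
    (enc_monomials [seq (m.1, - m.2) | m <- answer (enc_nats s)]).

(* The contents of the variables are described by an explicit list, so every
   command resets its temporary variables to [VNil]. *)
Definition runs c vs vs' : Prop :=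
  forall k, exists N, iter N (step compare oracle) (c :: k, nth VNil vs)
                      = (k, nth VNil vs').

Lemma update_nth vs x v :
  update (nth VNil vs) x v = nth VNil (set_nth VNil vs x v).
Proof. by apply: functional_extensionality => y; rewrite nth_set_nth. Qed.

Lemma runs_assign x e vs vs' :
  set_nth VNil vs x (eval compare (nth VNil vs) e) = vs' ->
  runs (x ::= e) vs vs'.
Proof. by move=> <- k; exists 1%N; rewrite /= update_nth. Qed.

Lemma runs_query x e vs vs' :
  set_nth VNil vs x (oracle (eval compare (nth VNil vs) e)) = vs' ->
  runs (CQuery x e) vs vs'.
Proof. by move=> <- k; exists 1%N; rewrite /= update_nth. Qed.

Lemma runs_seq c1 c2 vs1 vs2 vs3 :
  runs c1 vs1 vs2 -> runs c2 vs2 vs3 -> runs (c1 ;; c2) vs1 vs3.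
Proof.
move=> r1 r2 k; have [N1 e1] := r1 (c2 :: k); have [N2 e2] := r2 k.
by exists (N2 + N1.+1)%N; rewrite iterD iterSr e1.
Qed.

Lemma runs_if e c1 c2 vs vs' :
  runs (if vtrue (eval compare (nth VNil vs) e) then c1 else c2) vs vs' ->
  runs (CIf e c1 c2) vs vs'.
Proof. by move=> r k; have [N eN] := r k; exists N.+1; rewrite iterSr. Qed.

Lemma runs_while_stop e c vs :
  ~~ vtrue (eval compare (nth VNil vs) e) -> runs (CWhile e c) vs vs.
Proof. by move=> /negPf ve k; exists 1%N; rewrite /= ve. Qed.

Lemma runs_while_step e c vs1 vs2 vs3 :
  vtrue (eval compare (nth VNil vs1) e) ->
  runs c vs1 vs2 -> runs (CWhile e c) vs2 vs3 -> runs (CWhile e c) vs1 vs3.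
Proof.
move=> ve r1 r2 k; have [N1 e1] := r1 (CWhile e c :: k); have [N2 e2] := r2 k.
by exists (N2 + N1.+1)%N; rewrite iterD iterSr /= ve e1.
Qed.

Ltac simp := rewrite /= /vnat2 /= ?subn1 ?addn1 /=.
(** Executes one leading assignment or query and lets unification find the resulting memory; loops
    and conditionals have their own lemmas. *)
Ltac run1 :=
  simp; first [apply: runs_seq; [run1|]; simp
    | apply: runs_assign; simp; reflexivity
    | apply: runs_query; simp; reflexivity].

Lemma runs_exponents v0 D L s m acc :
  runs cexponents
    [:: v0; D; L; enc_seq (map enc_nats acc); enc_nats s; VNat m;
        VNil; VNil; VNil; VNil; VNil; VNil]
    [:: v0; D; L;
        enc_seq (map enc_nats ([seq e :: s | e <- iota 0 m] ++ acc));
        enc_nats s; VNat 0; VNil; VNil; VNil; VNil; VNil; VNil].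
Proof.
elim: m acc => [|m IHm] acc; first exact: runs_while_stop.
apply: runs_while_step => //.
  by do 2 run1.
(* The countdown pushes the largest exponent first, so [iota] is split at its end. *)
have -> : iota 0 m.+1 = rcons (iota 0 m) m by rewrite -addn1 iotaD cats1.
rewrite map_rcons cat_rcons; exact: (IHm ((m :: s) :: acc)).
Qed.

Lemma runs_extend v0 D L acc :
  runs cextend
    [:: v0; VNat D; enc_seq (map enc_nats L); enc_seq (map enc_nats acc);
        VNil; VNil; VNil; VNil; VNil; VNil; VNil; VNil]
    [:: v0; VNat D; VNil; enc_seq (map enc_nats (extend D L ++ acc));
        VNil; VNil; VNil; VNil; VNil; VNil; VNil; VNil].
Proof.
elim: L acc => [|s L IHL] acc; first exact: runs_while_stop.
apply: runs_while_step; first by [].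
  do 3 run1.
  apply: runs_seq; first exact: runs_exponents.
  do 2 run1.
(* Terms taken later from [L] end up nearer the head of the accumulator, hence the [rev] in
   [extend]. *)
rewrite /extend rev_cons map_rcons flatten_rcons -catA.
exact: (IHL ([seq e :: s | e <- iota 0 D.+1] ++ acc)).
Qed.

Lemma runs_box n D L :
  runs cbox
    [:: VNat n; VNat D; enc_seq (map enc_nats L); VNil;
        VNil; VNil; VNil; VNil; VNil; VNil; VNil; VNil]
    [:: VNat 0; VNat D; enc_seq (map enc_nats (iter n (extend D) L)); VNil;
        VNil; VNil; VNil; VNil; VNil; VNil; VNil; VNil].
Proof.
elim: n L => [|n IHn] L; first exact: runs_while_stop.
apply: runs_while_step; first by [].
  run1.
  apply: runs_seq; first exact: (runs_extend _ _ _ [::]).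
  rewrite cats0; do 2 run1.
by rewrite iterSr; apply: IHn.
Qed.

Lemma runs_revapp T (f : T -> value F) v0 D L t h r fl P S (l acc : seq T) :
  runs (crevapp 11 10)
    [:: v0; D; L; VNil; t; h; r; fl; P; S;
        enc_seq (map f acc); enc_seq (map f l)]
    [:: v0; D; L; VNil; t; h; r; fl; P; S;
        enc_seq (map f (catrev l acc)); VNil].
Proof.
elim: l acc => [|e l IHl] acc; first exact: runs_while_stop.
by apply: runs_while_step => //; [do 2 run1|apply: (IHl (e :: acc))].
Qed.

Lemma runs_preds v0 D L t r fl P S :
  runs cpreds
    [:: v0; D; L; VNil; t; VNil; r; fl; enc_nats P; enc_nats S; VNil; VNil]
    [:: v0; D; L; VNil; t; VNil; r;
        if all reduced (lowerings P S) then fl else VNil;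
        enc_nats (catrev S P); VNil; VNil; VNil].
Proof.
elim: S P fl => [|h S IHS] P fl; first exact: runs_while_stop.
(* The flag once the head entry alone has been treated; the rest of the loop can only clear it. *)
set fl1 := if all reduced
    (if (0 < h)%N then [:: catrev P (h.-1 :: S)] else [::])
           then fl else VNil.
apply: (@runs_while_step _ _ _
  [:: v0; D; L; VNil; t; VNil; r; fl1; enc_nats (h :: P); enc_nats S;
      VNil; VNil]) => //; last first.
  rewrite /= all_cat; have := IHS (h :: P) fl1; rewrite /fl1.
  by case: (all _ (if _ then _ else _)); case: (all _ _).
do 2 run1.
apply: (@runs_seq _ _ _
  [:: v0; D; L; VNil; t; VNat h; r; fl1; enc_nats P; enc_nats S;
      VNil; VNil]); last by do 2 run1.
apply: runs_if; rewrite {}/fl1; case: h => [|h]; first by run1.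
set x := catrev P (h :: S).
do 2 run1.
apply: runs_seq; first exact: (runs_revapp _ _ _ _ _ _ _ _ _ _ P (h :: S)).
run1; rewrite -/x andbT.
(* Only one branch clears variable 11, the other clears the flag; the assignments that follow reset
   10 and 11 in both cases. *)
apply: (@runs_seq _ _ _
  [:: v0; D; L; VNil; t; VNat h.+1; r; if reduced x then fl else VNil;
      enc_nats P; enc_nats S; enc_nats x;
      if reduced x then VNil else oracle (enc_nats x)]); last by do 2 run1.
apply: runs_if; rewrite -[eval _ _ _]/(vbool F (reduced x)).
by case: (reduced x); run1.
Qed.

Lemma runs_neg v0 D L t fl P (l acc : seq (value F * F)) :
  runs cneg
    [:: v0; D; L; VNil; t; VNil; enc_monomials l; fl; P; VNil;
        enc_monomials acc; VNil]
    [:: v0; D; L; VNil; t; VNil; VNil; fl; P; VNil;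
        enc_monomials (catrev [seq (m.1, - m.2) | m <- l] acc); VNil].
Proof.
elim: l acc => [|[u c] l IHl] acc; first exact: runs_while_stop.
by apply: runs_while_step => //; [do 2 run1|apply: (IHl ((u, - c) :: acc))].
Qed.

Lemma runs_emit D L s fl P v :
  runs cemit
    [:: v; D; L; VNil; enc_nats s; VNil; oracle (enc_nats s); fl; P;
        VNil; VNil; VNil]
    [:: VPair (basis_value s) v; D; L; VNil; enc_nats s; VNil; VNil; fl; P;
        VNil; VNil; VNil].
Proof.
apply: runs_seq; first exact: (runs_neg _ _ _ _ _ _ _ [::]).
do 2 run1.
apply: runs_seq; first exact: (runs_revapp _ _ _ _ _ _ _ _ _ _ _ [::]).
rewrite -!/(rev _) revK; by do 2 run1.
Qed.

Lemma runs_select D Ls acc :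
  runs cselect
    [:: enc_seq (map basis_value acc); D; enc_seq (map enc_nats Ls);
        VNil; VNil; VNil; VNil; VNil; VNil; VNil; VNil; VNil]
    [:: enc_seq (map basis_value (catrev (filter basis_term Ls) acc)); D;
        VNil; VNil; VNil; VNil; VNil; VNil; VNil; VNil; VNil; VNil].
Proof.
elim: Ls acc => [|s Ls IHL] acc; first exact: runs_while_stop.
apply: (@runs_while_step _ _ _
  [:: enc_seq (map basis_value (if basis_term s then s :: acc else acc)); D;
      enc_seq (map enc_nats Ls);
      VNil; VNil; VNil; VNil; VNil; VNil; VNil; VNil; VNil]) => //; last first.
  by rewrite /=; case: (basis_term s); exact: IHL.
do 3 run1.
apply: (@runs_seq _ _ _
  [:: enc_seq (map basis_value (if basis_term s then s :: acc else acc)); D;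
      enc_seq (map enc_nats Ls); VNil; enc_nats s;
      VNil; VNil; VNil; VNil; VNil; VNil; VNil]); last by run1.
apply: runs_if; rewrite -[eval _ _ _]/(vbool F (reduced s)) /basis_term.
case: (reduced s) => /=; first by run1.
do 2 run1.
apply: runs_seq; first exact: (runs_preds _ _ _ _ _ _ [::]).
run1.
apply: (@runs_seq _ _ _
  [:: enc_seq (map basis_value
        (if all reduced (lowerings [::] s) then s :: acc else acc)); D;
      enc_seq (map enc_nats Ls); VNil; enc_nats s; VNil; VNil;
      if all reduced (lowerings [::] s) then VNat 1 else VNil;
      VNil; VNil; VNil; VNil]); last by run1.
by apply: runs_if; case: (all _ _) => /=; [apply: runs_emit | run1].
Qed.

Lemma outputs_groebner n D :
  outputs compare oracle cgroebner (init (VNat n) (VNat D))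
    (enc_seq [seq basis_value s | s <- rev (filter basis_term (box n D))]).
Proof.
set out := enc_seq _.
suff r : runs cgroebner
    [:: VNat n; VNat D; VNil;
        VNil; VNil; VNil; VNil; VNil; VNil; VNil; VNil; VNil]
    [:: out; VNat D; VNil;
        VNil; VNil; VNil; VNil; VNil; VNil; VNil; VNil; VNil].
  have [N eN] := r [::]; exists N.
  (* Only variables 0 to 11 occur in the program, and beyond them the default of [nth] agrees with
     [init]. *)
  have -> : init (VNat n) (VNat D) = nth (@VNil F) [:: VNat n; VNat D; VNil;
        VNil; VNil; VNil; VNil; VNil; VNil; VNil; VNil; VNil].
    apply: functional_extensionality => x.
    by do 12![case: x => [|x] //]; case: x.
  by rewrite eN.
run1; apply: runs_seq; first exact: (runs_box _ _ [:: [::]]).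
run1; exact: (runs_select _ _ [::]).
Qed.

End Run.

(** * Canonical forms and the minimal basis G(I) *)

Section Canonical.

Context (F : fieldType) (n : nat) (prec : rel 'X_{1..n}).
Context (I : {mpoly F[n]} -> Prop).
Hypotheses (idealI : is_ideal I) (prec_order : term_ordering prec).

Implicit Types (f g : {mpoly F[n]}) (t u : 'X_{1..n}).

Local Notation lead := (lead_terms prec I).
Local Notation normal := (normal_terms prec I).
Local Notation canonical := (is_canonical prec I).
Local Notation can t := (Can prec I 'X_[t]).

Lemma prec_asym t u : prec t u -> ~~ prec u t.
Proof.
move=> tu; apply/negP => /(prec_trans prec_order tu).
by apply/negP/(prec_irr prec_order).
Qed.

Lemma idealZ (c : F) f : I f -> I (c *: f).
Proof. by rewrite -mul_mpolyC; apply: idealM. Qed.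

Lemma idealB f g : I f -> I g -> I (f - g).
Proof.
by move=> If Ig; rewrite -scaleN1r; apply: (idealD idealI) => //; apply: idealZ.
Qed.

Lemma exists_leading f : f != 0 -> exists t, is_leading prec f t.
Proof.
rewrite -msupp_eq0 /is_leading; elim: (msupp f) => // t [|u s] IHs _.
  by exists t; split=> [|v]; rewrite ?mem_head // mem_seq1 => ->.
have [//|v [sv max_v]] := IHs.
have [-> | t_neq_v] := eqVneq t v.
  exists v; split=> [|w]; rewrite ?mem_head // in_cons.
  by case/predU1P=> [->|/max_v]; rewrite ?eqxx.
have /orP[tv | vt] := prec_total prec_order t_neq_v.
  exists v; split=> [|w]; rewrite in_cons ?sv ?orbT //.
  by case/predU1P=> [-> //|]; apply: max_v.
exists t; split=> [|w]; rewrite ?mem_head // in_cons.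
case/predU1P=> [->|/max_v sw _]; first by rewrite eqxx.
by have [-> //| /sw wv] := eqVneq w v; apply: (prec_trans prec_order wv).
Qed.

Lemma canonical0 : canonical 0 0.
Proof. by split=> [t|]; rewrite ?msupp0 // subr0; apply: ideal0. Qed.

Lemma canonicalD f1 f2 g1 g2 :
  canonical f1 g1 -> canonical f2 g2 -> canonical (f1 + f2) (g1 + g2).
Proof.
move=> [N1 I1] [N2 I2]; split=> [t /msuppD_le|].
  by rewrite mem_cat => /orP[/N1 | /N2].
by rewrite opprD addrACA; apply: idealD.
Qed.

Lemma canonicalZ (c : F) f g : canonical f g -> canonical (c *: f) (c *: g).
Proof.
move=> [Ng Ifg]; split=> [t /msuppZ_le /Ng //|].
by rewrite -scalerBr; apply: idealZ.
Qed.

Lemma canonical_exists_support f :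
  (forall t, t \in msupp f -> exists g, canonical 'X_[t] g) ->
  exists g, canonical f g.
Proof.
(* Only the [f] of the conclusion is expanded, so that the coefficients stay fixed during the
   induction on the support. *)
rewrite {2}[f]mpolyE; elim: (msupp f) => [|t s IHs] can_s.
  by exists 0; rewrite big_nil; apply: canonical0.
have [g1 can_g1] := can_s t (mem_head _ _).
have [|g2 can_g2] := IHs.
  by move=> u su; apply: can_s; rewrite in_cons su orbT.
exists (f@_t *: g1 + g2); rewrite big_cons.
by apply/canonicalD/can_g2/canonicalZ.
Qed.

(** Well-founded induction on [t]: a normal term is its own canonical form; otherwise a monic
    element of [I] with leading term [t] is subtracted, which leaves only smaller terms. *)
Lemma canonical_exists t : exists g, canonical 'X_[t] g.
Proof.
elim/(well_founded_ind (prec_wf prec_order)): t => t IHt.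
have [[f [If _ [ft f_max]]] | N_t] := classic (lead t); last first.
  exists 'X_[t]; split=> [u|]; first by rewrite msuppX mem_seq1 => /eqP ->.
  by rewrite subrr; apply: ideal0.
pose f1 := (f@_t)^-1 *: f.
have f_t : f@_t != 0 by rewrite -mcoeff_msupp.
have [u|g [Ng Ig]] := @canonical_exists_support ('X_[t] - f1).
  rewrite mcoeff_msupp mcoeffB mcoeffX mcoeffZ => Xfu.
  have neq_ut : u != t.
    by apply: contraNneq Xfu => ->; rewrite eqxx mulVf // subrr.
  apply/IHt/f_max => //; rewrite mcoeff_msupp; apply: contraNneq Xfu => ->.
  by rewrite [t == u]eq_sym (negPf neq_ut) mulr0 subr0.
exists g; split=> //; rewrite -[_ - g](subrK f1) [_ - g - f1]addrAC.
by apply: idealD => //; apply: idealZ.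
Qed.

Lemma CanP t : canonical 'X_[t] (can t).
Proof. apply: epsilon_spec; exact: canonical_exists. Qed.

(** A nonzero difference would lie in [I], while its leading term occurs in [g1] or [g2] and is
    therefore normal. *)
Lemma canonical_unique f g1 g2 : canonical f g1 -> canonical f g2 -> g1 = g2.
Proof.
move=> [N1 I1] [N2 I2]; apply/eqP; rewrite -subr_eq0; apply/negPn/negP => neq.
have [t lead_t] := exists_leading neq; have [/msuppB_le] := lead_t.
rewrite mem_cat => g_t _.
suff : lead t by case/orP: g_t => [/N1 | /N2].
exists (g1 - g2); split=> //.
have -> : g1 - g2 = (f - g2) - (f - g1).
  by rewrite opprB [f - g2]addrC addrACA subrr addr0 addrC.
exact: idealB.
Qed.

Lemma normal_Can t : normal t -> can t = 'X_[t].
Proof.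
move=> N_t; apply: (canonical_unique (CanP t)); split=> [u|].
  by rewrite msuppX mem_seq1 => /eqP ->.
by rewrite subrr; apply: ideal0.
Qed.

Lemma lead_notin_Can t u : lead t -> t \notin msupp (can u).
Proof. by move=> lead_t; apply/negP => /(CanP u).1. Qed.

Lemma mcoeff_basis t : lead t -> ('X_[t] - can t)@_t = 1.
Proof.
move=> /(lead_notin_Can t)/memN_msupp_eq0 cant.
by rewrite mcoeffB mcoeffX eqxx cant subr0.
Qed.

(** The leading term of t - Can t belongs to T(I), so it cannot come from Can t and must be [t]. *)
Lemma prec_Can t u : lead t -> u \in msupp (can t) -> prec u t.
Proof.
move=> lead_t cu; have t_notin := lead_notin_Can t lead_t.
have f_neq0 : 'X_[t] - can t != 0.
  apply/eqP => f0; have := mcoeff_basis lead_t.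
  by rewrite f0 mcoeff0 => /esym/eqP; rewrite oner_eq0.
have [v lead_v] := exists_leading f_neq0.
have Lv : lead v by exists ('X_[t] - can t); split=> //; case: (CanP t).
case: lead_v => [/msuppB_le]; rewrite mem_cat msuppX mem_seq1.
rewrite (negPf (lead_notin_Can t Lv)) orbF => /eqP -> f_max.
have neq_ut : u != t by apply: contraNneq t_notin => eq_ut; rewrite -{1}eq_ut.
apply: f_max (neq_ut) => //.
rewrite mcoeff_msupp mcoeffB mcoeffX [t == u]eq_sym (negPf neq_ut).
by rewrite sub0r oppr_eq0 -mcoeff_msupp.
Qed.

Lemma lead_mul t u : (t <= u)%MM -> lead t -> lead u.
Proof.
move=> /submK <- [f [If f0 [ft f_max]]].
exists (f * 'X_[u - t]); split.
- by rewrite mulrC; apply: idealM.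
- rewrite -msupp_eq0 -size_eq0 (perm_size (msuppMX _ _)).
  by rewrite size_map size_eq0 msupp_eq0.
split=> [|v]; rewrite (perm_mem (msuppMX _ _)); first exact: map_f.
case/mapP=> w fw -> neq; apply: (prec_mul prec_order); apply: f_max => //.
by apply: contraNneq neq => ->.
Qed.

(** The local description of G(I) that the program tests; [lead_basisP] proves it equivalent to
    [lead_basis]. *)
Definition minimal_lead t : Prop :=
  lead t /\ forall i, (0 < t i)%N -> normal (t - U_(i))%MM.

Lemma mnm_lt_lower t u : (t <= u)%MM -> t != u ->
  exists2 i, (0 < u i)%N & (t <= u - U_(i))%MM.
Proof.
move=> /mnm_lepP tu /eqP neq.
have [i lti] : exists i, (t i < u i)%N.
  apply/existsP; apply: contra_notT neq => /existsPn ge; apply/mnmP => i.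
  by apply/eqP; rewrite eqn_leq tu leqNgt ge.
exists i; first exact: leq_ltn_trans lti.
apply/mnm_lepP => j; rewrite mnmBE mnm1E.
have [<-|] := eqVneq i j; rewrite ?subn0 // subn1 -ltnS prednK //.
exact: leq_ltn_trans lti.
Qed.

(** Dividing by variables as long as the quotient stays in T(I) must stop, since the degree drops
    each time. *)
Lemma minimal_lead_generates : generates minimal_lead lead.
Proof.
move=> t; split=> [|[u [lead_u _] /lead_mul]]; last exact.
elim: {t}_.+1 {-2}t (ltnSn (mdeg t)) => // d IHd t; rewrite ltnS => le_d lead_t.
have [[i [ti lead_ti]] | min_t] :=
  classic (exists i, (0 < t i)%N /\ lead (t - U_(i))%MM).
  have [|//|u min_u ut] := IHd (t - U_(i))%MM.
    have U_le : (U_(i) <= t)%MM by rewrite lep1mP -lt0n.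
    by rewrite -(submK U_le) mdegD mdeg1 addn1 in le_d.
  by exists u => //; apply: lepm_trans ut (lem_subr _ _).
exists t; last exact: lepm_refl.
by split=> // i ti lead_ti; apply: min_t; exists i.
Qed.

(** A generator properly dividing [t] would divide some t / X_i and put it in T(I); hence the
    generator below [t] is [t] itself. *)
Lemma minimal_lead_sub (B : 'X_{1..n} -> Prop) t :
  generates B lead -> minimal_lead t -> B t.
Proof.
move=> genB [/genB[u Bu ut] min_t].
have [<- // | neq] := eqVneq u t.
have [i ti uti] := mnm_lt_lower ut neq.
by case: (min_t i ti); apply/genB; exists u.
Qed.

Lemma lead_basisP t : lead_basis prec I t <-> minimal_lead t.
Proof.
have [genB minB] : minimal_basis lead (lead_basis prec I).
  apply: epsilon_spec; exists minimal_lead; split.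
    exact: minimal_lead_generates.
  by move=> B' _ genB' u; apply: minimal_lead_sub.
split; last exact: minimal_lead_sub.
(* The minimality of the chosen basis is applied to the competitor [minimal_lead], which is
   contained in it. *)
apply: minB; last exact: minimal_lead_generates.
by move=> u; apply: minimal_lead_sub.
Qed.

(** The coefficient of [t] is 1 on the left; on the right Can u contributes nothing to it, so it
    must come from [u]. *)
Lemma basis_inj t u : lead t -> lead u ->
  'X_[t] - can t = 'X_[u] - can u -> t = u.
Proof.
move=> lead_t lead_u eq_tu; have := mcoeff_basis lead_t.
rewrite eq_tu mcoeffB mcoeffX (memN_msupp_eq0 (lead_notin_Can u lead_t)) subr0.
by case: (u =P t) => //= _ /esym/eqP; rewrite oner_eq0.
Qed.

Lemma minimal_lead_bound D t :
  (forall g, groebner prec I g -> tdeg g <= D)%N -> minimal_lead t ->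
  (mdeg t <= D)%N.
Proof.
move=> leD min_t.
apply: leq_trans (leD ('X_[t] - can t) _); last first.
  by exists t => //; apply/lead_basisP.
have : t \in msupp ('X_[t] - can t).
  by rewrite mcoeff_msupp mcoeff_basis ?oner_neq0 //; case: min_t.
(* [msize] exceeds the degree by one, which turns the strict bound into the weak one. *)
by move/msize_mdeg_lt; rewrite /tdeg; case: (msize _).
Qed.

End Canonical.

Lemma value_eqbP (F : fieldType) (u v : value F) :
  reflect (u = v) (value_eqb u v).
Proof.
apply: (iffP idP) => [|<- {v}]; last first.
  by elim: u => //= u -> v ->.
elim: u v => [|i|a|u1 IHu u2 IHv] [|j|b|v1 v2] //=.
- by move/eqP->.
- by move/eqP->.
by case/andP=> /IHu-> /IHv->.
Qed.

(** * Encodings and the actual oracle *)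

Section Encoding.

Context (F : fieldType) (n : nat).

Implicit Types (s : seq nat) (t u : 'X_{1..n}).

Definition mnm_of_seq s : 'X_{1..n} := [multinom nth 0%N s i | i < n].

Lemma mnm_of_seqK t : mnm_of_seq t = t.
Proof. by apply/mnmP => i; rewrite mnmE mnm_tnth (tnth_nth 0%N). Qed.

Lemma mnm_of_seq_inj s1 s2 : size s1 = n -> size s2 = n ->
  mnm_of_seq s1 = mnm_of_seq s2 -> s1 = s2.
Proof.
move=> n1 n2 /mnmP eq12.
apply: (@eq_from_nth _ 0%N) => [|i]; first by rewrite n1.
by rewrite n1 => lti; have := eq12 (Ordinal lti); rewrite !mnmE.
Qed.

Lemma mnm_of_seq_lower s (i : 'I_n) :
  mnm_of_seq (set_nth 0%N s i (nth 0%N s i).-1) = (mnm_of_seq s - U_(i))%MM.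
Proof.
apply/mnmP => j; rewrite mnmBE mnm1E !mnmE nth_set_nth /= -val_eqE /= eq_sym.
by case: eqP => [->|_]; rewrite ?subn1 ?subn0.
Qed.

Lemma enc_mnm_of_seq s : size s = n -> enc_term F (mnm_of_seq s) = enc_nats F s.
Proof.
move=> size_s; congr enc_seq.
rewrite -{2}(mkseq_nth 0%N s) size_s /mkseq -val_enum_ord -!map_comp.
by apply: eq_map => i; rewrite /= mnmE.
Qed.

(** No condition on the length of [s]: both sides read missing exponents as 0. *)
Lemma dec_enc_nats s : dec_term n (enc_nats F s) = mnm_of_seq s.
Proof.
apply/mnmP => i; rewrite !mnmE; elim: {i}(i : nat) s => [|i IHi] [|k s] //.
  by rewrite iterSr nth_nil -[RHS](nth_nil 0%N i); apply: (IHi [::]).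
by rewrite iterSr; apply: IHi.
Qed.

Lemma enc_termK t : dec_term n (enc_term F t) = t.
Proof.
rewrite -[in LHS](mnm_of_seqK t) enc_mnm_of_seq ?size_tuple //.
by rewrite dec_enc_nats mnm_of_seqK.
Qed.

Context (prec : rel 'X_{1..n}) (I : {mpoly F[n]} -> Prop).
Hypotheses (idealI : is_ideal I) (prec_order : term_ordering prec).

Local Notation lead := (lead_terms prec I).
Local Notation normal := (normal_terms prec I).
Local Notation can t := (Can prec I 'X_[t]).
Local Notation prec_ge := (fun t u => ~~ prec t u).

(** With the next two lemmas, this makes a sorted list unique up to permutation of its input. *)
Lemma prec_ge_total : total prec_ge.
Proof.
move=> t u; rewrite -negb_and; apply/negP => /andP[tu].
exact/negP/(prec_asym prec_order tu).
Qed.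

Lemma prec_ge_anti : antisymmetric prec_ge.
Proof.
move=> t u /andP[/negPf tu /negPf ut]; apply/eqP/negPn/negP.
by move/(prec_total prec_order); rewrite tu ut.
Qed.

Lemma prec_ge_trans : transitive prec_ge.
Proof.
move=> u t v tu uv; apply/negP => tv.
have [eq_tu|neq] := eqVneq t u; first by rewrite eq_tu (negPf uv) in tv.
have := prec_total prec_order neq; rewrite (negPf tu) => /= ut.
by case/negP: uv; apply: (prec_trans prec_order ut tv).
Qed.

Definition can_monomials (v : value F) : seq (value F * F) :=
  let g := can (dec_term n v) in
  [seq (enc_term F t, g@_t) | t <- sort prec_ge (msupp g)].

Lemma can_oracleE :
  can_oracle prec I = fun v => enc_monomials (can_monomials v).
Proof.
by apply: functional_extensionality => v; rewrite /enc_monomials -map_comp.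
Qed.

(** Normal terms are their own canonical form; conversely, the answer [t] puts [t] in the support of
    Can t, which contains normal terms only. *)
Lemma reducedP s : size s = n ->
  reduced can_monomials s <-> normal (mnm_of_seq s).
Proof.
move=> size_s; rewrite /reduced /can_monomials dec_enc_nats.
split=> [/value_eqbP | N_s]; last first.
  apply/value_eqbP; rewrite (normal_Can idealI prec_order N_s) msuppX /=.
  by rewrite enc_mnm_of_seq // mcoeffX eqxx.
set t := mnm_of_seq s; set L := sort _ _ => eq_L lead_t.
have: t \notin L by rewrite mem_sort lead_notin_Can.
case: L eq_L => [//|u L] [eq_u _ _].
by rewrite -[u]enc_termK eq_u dec_enc_nats mem_head.
Qed.

Lemma basis_termP s : size s = n ->
  basis_term can_monomials s <-> minimal_lead prec I (mnm_of_seq s).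
Proof.
move=> size_s; have size_lower i : (i < n)%N ->
    size (set_nth 0%N s i (nth 0%N s i).-1) = n.
  by rewrite size_set_nth size_s => /maxn_idPr.
rewrite /basis_term; split=> [/andP[nred /allP red_low]|[lead_s low]].
  split=> [|i].
    by apply: NNPP => /(reducedP size_s); apply/negP.
  rewrite mnmE => si; rewrite -mnm_of_seq_lower; apply/reducedP.
    exact: size_lower.
  by apply/red_low/mem_lowerings; exists i; rewrite size_s.
apply/andP; split; first by apply/negP => /(reducedP size_s).
apply/allP => x /mem_lowerings[i []]; rewrite size_s => lti si -> {x}.
apply/reducedP; first exact: size_lower.
by rewrite (mnm_of_seq_lower s (Ordinal lti)); apply: low; rewrite mnmE.
Qed.

(** Both lists are sorted, the right one by [prec_Can], and they have the same elements. *)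
Lemma sort_msupp_basis t : lead t ->
  sort prec_ge (msupp ('X_[t] - can t)) = t :: sort prec_ge (msupp (can t)).
Proof.
move=> lead_t; have t_notin := lead_notin_Can idealI prec_order t lead_t.
apply: (sorted_eq prec_ge_trans prec_ge_anti).
- exact/sort_sorted/prec_ge_total.
- rewrite /= (path_sortedE prec_ge_trans) sort_sorted ?andbT;
    last exact: prec_ge_total.
  apply/allP => u; rewrite mem_sort => /(prec_Can idealI prec_order lead_t).
  exact: prec_asym.
apply: uniq_perm; rewrite /= ?sort_uniq ?mem_sort ?t_notin ?msupp_uniq // => u.
rewrite mem_sort in_cons mem_sort !mcoeff_msupp mcoeffB mcoeffX [t == u]eq_sym.
have [->|_] := eqVneq u t; last by rewrite sub0r oppr_eq0.
by rewrite (memN_msupp_eq0 t_notin) subr0 oner_eq0.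
Qed.

Lemma basis_valueE s : size s = n -> lead (mnm_of_seq s) ->
  basis_value can_monomials s =
    enc_poly prec ('X_[mnm_of_seq s] - can (mnm_of_seq s)).
Proof.
move=> size_s lead_s.
have s_notin := lead_notin_Can idealI prec_order (mnm_of_seq s) lead_s.
rewrite /enc_poly sort_msupp_basis //= mcoeff_basis // enc_mnm_of_seq //.
congr VPair; rewrite /enc_monomials /can_monomials dec_enc_nats -!map_comp.
congr enc_seq; apply/eq_in_map => u; rewrite mem_sort => su /=.
(* Away from the leading term the coefficients are those of Can t negated; the leading term itself
   does not occur in Can t. *)
rewrite mcoeffB mcoeffX; case: eqP su => [<-|_ _]; last by rewrite sub0r.
by rewrite (negPf s_notin).
Qed.

End Encoding.

(* Correctness of the procedure *)
Local Close Scope cmd_scope.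
Local Close Scope ring_scope.

Theorem mainTheorem2 :
  exists p : cmd,
    forall (F : fieldType) (n : nat) (I : {mpoly F[n]} -> Prop)
           (prec : rel 'X_{1..n}) (D : nat),
      is_ideal I ->
      term_ordering prec ->
      (forall g : {mpoly F[n]}, groebner prec I g -> tdeg g <= D) ->
      exists gs : seq {mpoly F[n]},
        [/\ uniq gs,
            (forall g : {mpoly F[n]}, g \in gs <-> groebner prec I g)
          & computes prec p I D gs].
Proof.
exists cgroebner => F n I prec D idealI prec_order leD.
(* The output is built by consing, hence the [rev]. *)
pose ss := rev (filter (basis_term (can_monomials prec I)) (box n D)).
pose gb t := ('X_[t] - Can prec I 'X_[t])%R.
have ssP s : s \in ss -> size s = n /\ minimal_lead prec I (mnm_of_seq n s).
  rewrite mem_rev mem_filter mem_box => /andP[bs /andP[/eqP size_s _]].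
  by split=> //; apply/basis_termP.
exists (map (gb \o mnm_of_seq n) ss); split.
- rewrite map_inj_in_uniq ?rev_uniq ?filter_uniq ?box_uniq // => s1 s2.
  move=> /ssP[n1 [lead1 _]] /ssP[n2 [lead2 _]].
  move=> /(basis_inj idealI prec_order lead1 lead2).
  exact: mnm_of_seq_inj.
- move=> g; split=> [/mapP[s /ssP[_ min_s] ->]|].
    by exists (mnm_of_seq n s) => //; apply/lead_basisP.
  move=> [t /(lead_basisP idealI prec_order) min_t ->].
  rewrite -[t]mnm_of_seqK; apply/(map_f (gb \o mnm_of_seq n)).
  rewrite mem_rev mem_filter mem_box size_tuple eqxx /=.
  apply/andP; split.
    by apply/basis_termP; rewrite ?size_tuple ?mnm_of_seqK.
  (* Each exponent of [t] is at most its degree, hence at most [D], so the enumeration reaches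
     [t]. *)
  apply/allP => _ /tnthP[i ->]; rewrite -mnm_tnth.
  apply: leq_trans (minimal_lead_bound idealI prec_order leD min_t).
  by rewrite mdegE (bigD1 i) //= leq_addr.
rewrite /computes can_oracleE -map_comp.
have -> : map (enc_poly prec \o (gb \o mnm_of_seq n)) ss =
    map (basis_value (can_monomials prec I)) ss.
  by apply/eq_in_map => s /ssP[size_s [lead_s _]]; rewrite basis_valueE.
exact: outputs_groebner.
Qed.
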